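(* Let $q$ be a prime power, let $d\ge 2$ be a divisor of $q-1$, and let $\ell\ge 1$ be an integer with $\frac{q-1}{d}-\ell>1$. Let $f(x)=x^{\frac{q-1}{d}-\ell}+g(x)\in\mathbb{F}_q[x]$, where $g(x)\in\mathbb{F}_q[x]$ satisfies $1\le g^\circ<\frac{q-1}{d}-\ell$ and $g$ (equivalently $f$) has nonzero constant term. Then the following hold. (1) If $\ell>\frac{q-1}{d(d+1)}$ and $i\ge -1$ is the largest integer such that $$\ell+g^\circ<(q-1)\left(\frac{1+d^{-2i-1}}{d(d+1)}\right),$$ then $$|Z(f)|\le\frac{q-1}{d+1}-d^{2i+2}\left(\ell-\frac{q-1}{d(d+1)}\right).$$ (2) If $\ell+g^\circ<\frac{q-1}{d(d+1)}$ and $i\ge -1$ is the largest integer such that $$\ell>(q-1)\left(\frac{1-d^{-2i-2}}{d(d+1)}\right),$$ then $$|Z(f)|\le\frac{q-1}{d+1}-d^{2i+3}\left(\frac{q-1}{d(d+1)}-(\ell+g^\circ)\right).$$ (3) If $\ell\le\frac{q-1}{d(d+1)}$, $\ell+g^\circ\ge\frac{q-1}{d(d+1)}$, and $d(d+1)\ell+d^2g^\circ<q-1$, then $|Z(f)|\le d(\ell+g^\circ)$. (4) If $\ell\le\frac{q-1}{d(d+1)}$, $\ell+g^\circ\ge\frac{q-1}{d(d+1)}$, and $d(d+1)\ell+d^2g^\circ\ge q-1$, then $|Z(f)|\le f^\circ=\frac{q-1}{d}-\ell$.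
   Context: For a polynomial $f(x)\in\mathbb{F}_q[x]$, $f^\circ$ denotes its degree and $Z(f)$ denotes the set of (distinct) roots of $f$ lying in $\mathbb{F}_q^*=\mathbb{F}_q\setminus\{0\}$. *)

(* Defs.v *)
From mathcomp Require Import all_boot all_order all_algebra.

Set Implicit Arguments.
Unset Strict Implicit.
Unset Printing Implicit Defensive.

Import Order.TTheory GRing.Theory Num.Theory.
Local Open Scope ring_scope.

(* For p = 0 this returns 0. *)
Definition deg (R : nzSemiRingType) (p : {poly R}) : nat := (size p).-1.

Definition Z (F : finFieldType) (p : {poly F}) : {set F} :=
  [set x : F | (x != 0) && root p x].

Definition is_largest (P : int -> Prop) (i : int) : Prop :=
  P i /\ forall j : int, P j -> j <= i.

(* Main.v *)
(* Put N = q - 1 and m = N/d - l.  A nonzero root x of f = X^m + g satisfies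
   x^m = -g(x), so for every multiple b of d, x^N = 1 gives
   (-g(x))^b x^(bl) = x^(b N/d) = 1.  Dividing by x^(cN) = 1 shows that the
   nonzero roots of f are roots of (-g)^b X^(bl - cN) - 1 if bl > cN, and of
   (-g)^b - X^(cN - bl) if cN > bl.  Case (2) is b = d^(2i+3) with
   c = (d^(2i+2) - 1)/(d + 1), case (1) is b = d^(2i+2) with
   c = (d^(2i+1) + 1)/(d + 1) unless i = -1, where its bound is m, and case (3)
   is b = d with c = 0. *)
Require Import Defs.
From mathcomp Require Import all_boot all_order all_algebra.
From mathcomp Require Import finfield ring lra zify.

Set Implicit Arguments.
Unset Strict Implicit.
Unset Printing Implicit Defensive.

Import Order.TTheory GRing.Theory Num.Theory.
Local Open Scope ring_scope.

Lemma card_Z_le_deg (F : finFieldType) (f p : {poly F}) :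
  p != 0 -> {in Z f, forall x, root p x} -> (#|Z f| <= deg p)%N.
Proof.
move=> p0 fp; rewrite cardE /deg -ltnS prednK ?size_poly_gt0 //.
apply: max_poly_roots => //; last exact: enum_uniq.
by apply/allP => x; rewrite mem_enum => /fp.
Qed.

Lemma size_exp_leq (R : nzRingType) (p : {poly R}) (n : nat) :
  (size (p ^+ n) <= (n * deg p).+1)%N.
Proof. by rewrite mulnC; exact: size_poly_exp_leq. Qed.

Lemma expf_card_pred (F : finFieldType) (x : F) : x != 0 -> x ^+ #|F|.-1 = 1.
Proof.
move=> x0; apply: (mulfI x0); rewrite mulr1 -exprS prednK ?expf_card //.
by apply/card_gt0P; exists 0.
Qed.

Section RootBounds.
Variables (F : finFieldType) (d l m : nat) (g : {poly F}).
Hypotheses (hml : ((m + l) * d)%N = #|F|.-1) (hg0 : g`_0 != 0).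
Local Notation f := ('X^m + g).

(** Substituting x^m for -g(x) turns the left side into x^(b(m + l)), and [hml] makes b(m + l) a
    multiple of q - 1 as soon as d divides b. *)
Lemma root_power_identity b x : (d %| b)%N -> x \in Z f ->
  (- g.[x]) ^+ b * x ^+ (b * l) = 1.
Proof.
move=> /dvdnP[k ->]; rewrite inE => /andP[x0 /rootP].
rewrite !hornerE => /eqP; rewrite addr_eq0 => /eqP <-.
rewrite -exprM -exprD.
have -> : (m * (k * d) + k * d * l = #|F|.-1 * k)%N by rewrite -hml; ring.
by rewrite exprM expf_card_pred // expr1n.
Qed.

(** The bound is b deg g + e with e = bl - c(q - 1), which bounds the degree of (-g)^b X^e - 1.
    Since e > 0, this polynomial takes the value -1 at 0, so it is nonzero. *)
Lemma card_Z_le_pos b c : (d %| b)%N -> (c * #|F|.-1 < b * l)%N ->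
  (#|Z f| <= b * (l + deg g) - c * #|F|.-1)%N.
Proof.
move=> db lt_cb; set e := (b * l - c * #|F|.-1)%N.
have e_gt0 : (0 < e)%N by rewrite subn_gt0.
pose p := (- g) ^+ b * 'X^e - 1 : {poly F}.
apply: (@leq_trans (deg p)).
  apply: card_Z_le_deg.
    apply/eqP => /(congr1 (horner^~ 0)) /eqP.
    by rewrite !hornerE expr0n gtn_eqF // mulr0 sub0r oppr_eq0 oner_eq0.
  move=> x xZ; apply/rootP; rewrite !hornerE.
  have := root_power_identity db xZ.
  rewrite -(subnK (ltnW lt_cb)) -/e exprD (mulnC c) exprM expf_card_pred.
    by rewrite expr1n mulr1 => ->; rewrite subrr.
  by move: xZ; rewrite inE => /andP[].
rewrite /deg -subn1 leq_subLR add1n.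
apply: leq_trans (size_polyD _ _) _; rewrite size_polyN size_poly1 geq_max andbT.
apply: leq_trans (size_polyMleq _ _) _; rewrite size_polyXn addnS /=.
have := size_exp_leq (- g) b; rewrite /deg size_polyN -/(deg g) -(leq_add2r e).
move=> /leq_trans; apply; rewrite mulnDr /e.
by rewrite addSn ltnS addnC -addnBAC // ltnW.
Qed.

(** The hypothesis says that e = c(q - 1) - bl exceeds b deg g, so (-g)^b - X^e has degree at most
    e. Its value at 0 is (-g(0))^b, nonzero by [hg0]. *)
Lemma card_Z_le_neg b c : (d %| b)%N -> (b * (l + deg g) < c * #|F|.-1)%N ->
  (#|Z f| <= c * #|F|.-1 - b * l)%N.
Proof.
move=> db lt_bc; set e := (c * #|F|.-1 - b * l)%N.
have e_gt : (b * deg g < e)%N by rewrite ltn_subRL -mulnDr.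
pose p := (- g) ^+ b - 'X^e : {poly F}.
apply: (@leq_trans (deg p)).
  apply: card_Z_le_deg.
    apply/eqP => /(congr1 (horner^~ 0)) /eqP.
    rewrite !hornerE expr0n gtn_eqF ?(leq_ltn_trans _ e_gt) // subr0.
    by rewrite expf_eq0 oppr_eq0 horner_coef0 (negPf hg0) andbF.
  move=> x xZ; apply/rootP; rewrite !hornerE.
  have x0 : x != 0 by move: xZ; rewrite inE => /andP[].
  have xb0 : x ^+ (b * l) != 0 by rewrite expf_neq0.
  (* Multiplying by x^(bl) turns (-g(x))^b into 1 and x^e into x^(c(q - 1)) = 1. *)
  apply: (mulIf xb0); rewrite mulrBl mul0r root_power_identity // -exprD.
  rewrite /e subnK; last by rewrite (leq_trans _ (ltnW lt_bc)) // leq_mul2l leq_addr orbT.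
  by rewrite mulnC exprM expf_card_pred // expr1n subrr.
rewrite /deg -subn1 leq_subLR add1n.
apply: leq_trans (size_polyD _ _) _; rewrite size_polyN size_polyXn geq_max leqnn andbT.
apply: leq_trans (size_exp_leq (- g) b) _.
by rewrite /deg size_polyN -/(deg g) ltnS ltnW.
Qed.

End RootBounds.

(** This holds because d^2 = (d - 1)(d + 1) + 1 is 1 modulo d + 1; it supplies the integer (d^(2k) -
    1)/(d + 1). *)
Lemma expn_even_subn1 d k : (0 < d)%N ->
  exists c, (d ^ (2 * k) = c * (d + 1) + 1)%N.
Proof.
move=> d0; elim: k => [|k [c hc]]; first by exists 0%N.
exists (d ^ 2 * c + (d - 1))%N.
rewrite mulnS expnD hc; case: d d0 {hc} => // d _; rewrite subn1 /=; ring.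
Qed.

Theorem theorem2p3 (F : finFieldType) (q d l : nat) (f g : {poly F})
    (hq : #|F| = q)
    (hd2 : (2 <= d)%N) (hd : (d %| q - 1)%N)
    (hl : (1 <= l)%N)
    (hm : (1 < (q - 1) %/ d - l)%N)
    (hf : f = 'X^((q - 1) %/ d - l) + g)
    (hg1 : (1 <= deg g)%N) (hg2 : (deg g < (q - 1) %/ d - l)%N)
    (hg0 : g`_0 != 0) :
  [/\ (* (1) *)
      forall i : int,
        l%:Q > (q%:Q - 1) / (d%:Q * (d%:Q + 1)) ->
        -1 <= i ->
        is_largest (fun j : int =>
          l%:Q + (deg g)%:Q <
            (q%:Q - 1) * ((1 + d%:Q ^ (- 2 * j - 1)) / (d%:Q * (d%:Q + 1)))) i ->
        #|Z f|%:Q <= (q%:Q - 1) / (d%:Q + 1)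
          - d%:Q ^ (2 * i + 2) * (l%:Q - (q%:Q - 1) / (d%:Q * (d%:Q + 1))),
      (* (2) *)
      forall i : int,
        l%:Q + (deg g)%:Q < (q%:Q - 1) / (d%:Q * (d%:Q + 1)) ->
        -1 <= i ->
        is_largest (fun j : int =>
          l%:Q >
            (q%:Q - 1) * ((1 - d%:Q ^ (- 2 * j - 2)) / (d%:Q * (d%:Q + 1)))) i ->
        #|Z f|%:Q <= (q%:Q - 1) / (d%:Q + 1)
          - d%:Q ^ (2 * i + 3)
              * ((q%:Q - 1) / (d%:Q * (d%:Q + 1)) - (l%:Q + (deg g)%:Q)),
      (* (3) *)
      l%:Q <= (q%:Q - 1) / (d%:Q * (d%:Q + 1)) ->
      l%:Q + (deg g)%:Q >= (q%:Q - 1) / (d%:Q * (d%:Q + 1)) ->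
      (d * (d + 1) * l + d ^ 2 * deg g < q - 1)%N ->
      (#|Z f| <= d * (l + deg g))%N
    & (* (4) *)
      l%:Q <= (q%:Q - 1) / (d%:Q * (d%:Q + 1)) ->
      l%:Q + (deg g)%:Q >= (q%:Q - 1) / (d%:Q * (d%:Q + 1)) ->
      (d * (d + 1) * l + d ^ 2 * deg g >= q - 1)%N ->
      (#|Z f| <= deg f)%N /\ deg f = ((q - 1) %/ d - l)%N].
Proof.
have d0 : (0 < d)%N by lia.
have q_gt0 : (0 < q)%N by rewrite -hq; apply/card_gt0P; exists 0.
set m := ((q - 1) %/ d - l)%N in hm hf hg2 *.
(* The subtraction in [m] is not truncated, because [hm] makes [m] positive. *)
have hml : ((m + l) * d)%N = #|F|.-1.
  by rewrite hq -subn1 -[RHS](divnK hd) /m subnK //; lia.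
have qN : q%:Q - 1 = (#|F|.-1)%:Q by rewrite hq -subn1 -subzn // intrB.
have degf : deg f = m.
  by rewrite hf /deg size_polyDl size_polyXn //; move: hg2; rewrite /deg; lia.
have f0 : f != 0 by rewrite -size_poly_gt0; move: degf; rewrite /deg; lia.
have Zm : (#|Z f| <= m)%N.
  by rewrite -degf; apply: card_Z_le_deg => // x; rewrite inE => /andP[].
have D0 : 0 < d%:Q by rewrite ltr0z; lia.
have exp2 k : d%:Q ^ (2 * k%:Z) = (d ^ (2 * k))%N%:Q by rewrite -PoszM -exprnP -!pmulrn natrX.
(* With k = i + 1, a natural number, all powers of d in (1) and (2) become d^(2k), its inverse, or
   one of these times d. *)
have intN (i : int) : -1 <= i -> exists k : nat, [/\ 2 * i + 2 = 2 * k%:Z, 2 * i + 3 = 2 * k%:Z + 1,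
    - 2 * i - 1 = 1 - 2 * k%:Z & - 2 * i - 2 = - (2 * k%:Z)].
  by move=> hi; exists (absz (i + 1)); split; lia.
set N := (#|F|.-1)%:Q in qN *.
have NE : N = (m%:Q + l%:Q) * d%:Q.
  by rewrite /N -hml PoszM PoszD intrM intrD.
split.
- move=> i _ /intN[k [-> _ e1 _]] [+ _]; rewrite e1 qN.
  rewrite expfzDr ?gt_eqF // -invr_expz exp2 expr1z.
  case: k {e1} => [|k] lt_lg.
    (* For i = -1 the claimed bound simplifies to m, the degree of f. *)
    rewrite NE muln0 expn0 mul1r.
    have -> : (m%:Q + l%:Q) * d%:Q / (d%:Q + 1) - (l%:Q -
        (m%:Q + l%:Q) * d%:Q / (d%:Q * (d%:Q + 1))) = m%:Q.
      by field; rewrite ?gt_eqF ?addr_gt0.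
    by rewrite ler_int; lia.
  (* Now i = k, and c = (d^(2k+1) + 1)/(d + 1) because c0 = (d^(2k) - 1)/(d + 1). *)
  have [c0 hc0] := expn_even_subn1 k d0; pose c := (d * c0 + 1)%N.
  set b := (d ^ (2 * k.+1))%N in lt_lg *.
  have hc : (d * c * (d + 1) = b + d)%N.
    by rewrite /b mulnS expnD hc0 /c; ring.
  have b0 : 0 < b%:Q by rewrite ltr0z ltz_nat expn_gt0 d0.
  have hcQ : b%:Q + d%:Q = d%:Q * c%:Q * (d%:Q + 1).
    by rewrite -[_ + 1]/(d%:Q + 1%:Q) -!(intrM, intrD) -!(PoszM, PoszD) hc.
  (* By the choice of c, the threshold that defines i equals cN/b. *)
  have lt_bc : (b * (l + deg g) < c * #|F|.-1)%N.
    rewrite -ltz_nat -(ltr_int rat) !PoszM PoszD !intrM intrD.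
    have eq_c : N * ((1 + d%:Q / b%:Q) / (d%:Q * (d%:Q + 1))) = c%:Q * N / b%:Q.
      have -> : 1 + d%:Q / b%:Q = (b%:Q + d%:Q) / b%:Q by field; rewrite ?gt_eqF ?addr_gt0.
      by rewrite hcQ; field; rewrite ?gt_eqF ?addr_gt0.
    by move: lt_lg; rewrite eq_c ltr_pdivlMr // mulrC.
  have := card_Z_le_neg hml hg0 (dvdn_exp (ltn0Sn _ : 0 < 2 * k.+1)%N (dvdnn d)) lt_bc.
  rewrite -hf -/b leq_subRL; last first.
    by rewrite (leq_trans _ (ltnW lt_bc)) // leq_mul2l leq_addr orbT.
  rewrite -lez_nat -(ler_int rat) PoszD !PoszM intrD !intrM -lerBrDl.
  congr (_ <= _).
  have -> : N / (d%:Q + 1) - b%:Q * (l%:Q - N / (d%:Q * (d%:Q + 1))) =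
      N * (b%:Q + d%:Q) / (d%:Q * (d%:Q + 1)) - b%:Q * l%:Q.
    by field; rewrite ?gt_eqF ?addr_gt0.
  by rewrite hcQ; field; rewrite ?gt_eqF ?addr_gt0.
- move=> i _ /intN[k [_ -> _ e1]] [+ _]; rewrite e1 qN.
  rewrite expfzDr ?gt_eqF // -invr_expz exp2 expr1z => lt_l.
  have [c hc] := expn_even_subn1 k d0.
  (* Here [b] is only d^(2i+2); the exponent passed to [card_Z_le_pos] is [b * d], and the threshold
     for l is cN/(bd). *)
  set b := (d ^ (2 * k))%N in lt_l hc *.
  have b0 : 0 < b%:Q by rewrite ltr0z ltz_nat expn_gt0 d0.
  have hcQ : b%:Q - 1 = c%:Q * (d%:Q + 1).
    by rewrite hc PoszD PoszM PoszD intrD intrM intrD addrK.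
  have lt_cb : (c * #|F|.-1 < b * d * l)%N.
    rewrite -ltz_nat -(ltr_int rat) !PoszM !intrM.
    have eq_c : N * ((1 - b%:Q^-1) / (d%:Q * (d%:Q + 1))) = c%:Q * N / (b%:Q * d%:Q).
      have -> : 1 - b%:Q^-1 = (b%:Q - 1) / b%:Q by field; rewrite ?gt_eqF ?addr_gt0.
      by rewrite hcQ; field; rewrite ?gt_eqF ?addr_gt0.
    by move: lt_l; rewrite eq_c ltr_pdivrMr ?mulr_gt0 // (mulrC l%:Q).
  have := card_Z_le_pos g hml (dvdn_mull b (dvdnn d)) lt_cb.
  rewrite -hf leq_subRL; last first.
    by rewrite (leq_trans (ltnW lt_cb)) // leq_mul2l leq_addr orbT.
  rewrite -lez_nat -(ler_int rat) PoszD !PoszM PoszD intrD !intrM intrD -lerBrDl.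
  congr (_ <= _).
  have -> : N / (d%:Q + 1) - b%:Q * d%:Q *
      (N / (d%:Q * (d%:Q + 1)) - (l%:Q + (deg g)%:Q)) =
      b%:Q * d%:Q * (l%:Q + (deg g)%:Q) - N * (b%:Q - 1) / (d%:Q + 1).
    by field; rewrite ?gt_eqF ?addr_gt0.
  by rewrite hcQ; field; rewrite ?gt_eqF ?addr_gt0.
- move=> _ _ _.
  (* With c = 0 and b = d, the condition of [card_Z_le_pos] is just 0 < dl. *)
  rewrite -[X in (_ <= X)%N]subn0 -(mul0n #|F|.-1) hf.
  apply: (card_Z_le_pos g hml) => //; rewrite mul0n muln_gt0; lia.
- by move=> _ _ _; split; rewrite ?degf.
Qed.
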